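(* Let $\mathbf A\in\mathbb R^{m\times n}$ and let $0\le s<\mathrm{rank}(\mathbf A)$ be an integer. Let $t_s=s+\mathrm{sr}_s(\mathbf A)$, let $0<\epsilon\le\frac12$, and let $k$ be an integer with $s+\frac{7}{\epsilon^4}\ln^2\frac1\epsilon\le k\le t_s-1$. If $S\sim k\text{-}\mathrm{DPP}(\mathbf A^\top\mathbf A)$, then \[ \frac{\mathbb E[\mathrm{Er}_{\mathbf A}(S)]}{\mathrm{OPT}_k}\le (1+2\epsilon)^2\,\Phi_s(k),\qquad\text{where}\quad \Phi_s(k)=\Big(1+\frac{s}{k-s}\Big)\sqrt{1+\frac{2(k-s)}{t_s-k}}. \]
   Context: For $\mathbf A\in\mathbb R^{m\times n}$ with columns $\mathbf a_1,\dots,\mathbf a_n$ and $S\subseteq\{1,\dots,n\}$, $\mathbf P_S$ denotes the orthogonal projection onto $\mathrm{span}\{\mathbf a_i:i\in S\}$ and $\mathrm{Er}_{\mathbf A}(S)=\|\mathbf A-\mathbf P_S\mathbf A\|_F^2$. $\mathrm{OPT}_k=\min_{\mathrm{rank}(\mathbf B)=k}\|\mathbf A-\mathbf B\|_F^2=\sum_{i>k}\lambda_i$, where $\lambda_1\ge\lambda_2\ge\dots\ge\lambda_n$ are the eigenvalues of $\mathbf A^\top\mathbf A$. The stable rank of order $s$ (for $0\le s<\mathrm{rank}(\mathbf A)$) is $\mathrm{sr}_s(\mathbf A)=\lambda_{s+1}^{-1}\sum_{i>s}\lambda_i$. For $\mathbf A_S$ the submatrix of columns indexed by $S$, $S\sim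 k\text{-}\mathrm{DPP}(\mathbf A^\top\mathbf A)$ denotes the distribution over subsets $S\subseteq\{1,\dots,n\}$ with $|S|=k$ and $\Pr(S)\propto\det(\mathbf A_S^\top\mathbf A_S)$. *)

(* Defs.v *)
From HB Require Import structures.
From mathcomp Require Import all_boot all_order all_algebra.
From mathcomp Require Import reals exp.
Set Implicit Arguments. Unset Strict Implicit. Unset Printing Implicit Defensive.
Import Order.TTheory GRing.Theory Num.Theory.
Local Open Scope ring_scope.

Section Defs.
Variable R : realType.

Definition frob2 (m n : nat) (M : 'M[R]_(m, n)) : R :=
  \sum_(i < m) \sum_(j < n) M i j ^+ 2.

(* The n x m matrix whose i-th row is the column a_i of A if i \in S, and 0
   otherwise; its row space is span{a_i : i \in S} (subspace of R^m). *)
Definition colsS (m n : nat) (A : 'M[R]_(m, n)) (S : {set 'I_n}) : 'M[R]_(n, m) :=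
  \matrix_(i < n, j < m) (if i \in S then A j i else 0).

(* Orthogonal projection P_S onto span{a_i : i in S}:  P = C^T (C C^T)^{-1} C,
   where the rows of C := row_base (colsS A S) form a basis of that span. *)
Definition projS (m n : nat) (A : 'M[R]_(m, n)) (S : {set 'I_n}) : 'M[R]_m :=
  let C := row_base (colsS A S) in
  C^T *m invmx (C *m C^T) *m C.

Definition Er (m n : nat) (A : 'M[R]_(m, n)) (S : {set 'I_n}) : R :=
  frob2 (A - projS A S *m A).

Definition gram_det (m n : nat) (A : 'M[R]_(m, n)) (S : {set 'I_n}) : R :=
  \det (\matrix_(i < #|S|, j < #|S|) (A^T *m A) (enum_val i) (enum_val j)).

Definition dpp_expected_Er (m n : nat) (A : 'M[R]_(m, n)) (k : nat) : R :=
  (\sum_(S : {set 'I_n} | #|S| == k) gram_det A S * Er A S)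
  / (\sum_(S : {set 'I_n} | #|S| == k) gram_det A S).

(* Eigenvalues lam_0 >= ... >= lam_{n-1} of A^T A (0-based: lam i is the
   paper's lambda_{i+1}), counted with algebraic multiplicity. *)
Definition sorted_eigenvalues (m n : nat) (A : 'M[R]_(m, n)) (lam : nat -> R) :=
  char_poly (A^T *m A) = \prod_(i < n) ('X - (lam i)%:P) /\
  (forall i j : nat, (i <= j < n)%N -> lam j <= lam i).

Definition OPT (n : nat) (lam : nat -> R) (k : nat) : R :=
  \sum_(i < n | (k <= i)%N) lam i.

Definition stable_rank (n : nat) (lam : nat -> R) (s : nat) : R :=
  (\sum_(i < n | (s <= i)%N) lam i) / lam s.

Definition Phi (s : nat) (t : R) (k : nat) : R :=
  (1 + s%:R / (k%:R - s%:R)) * Num.sqrt (1 + 2 * (k%:R - s%:R) / (t - k%:R)).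

End Defs.

(* Main.v *)
Require Import Defs.
From HB Require Import structures.
From mathcomp Require Import all_boot all_order all_algebra.
From mathcomp Require Import fingroup perm.
From mathcomp Require Import reals exp ring lra.
Import Order.TTheory GRing.Theory Num.Theory.
Local Open Scope ring_scope.

(* Write e_k for the elementary symmetric polynomials of the eigenvalues lam_i of
   A^T A.  Principal minors of A^T A of size k sum to e_k, and
   det(A_S^T A_S) * |a_j - P_S a_j|^2 = det(A_(S+j)^T A_(S+j)), whence
   E[Er(S)] = (k+1) b with b = e_(k+1) / e_k.  If q is the generating polynomial
   of the e_j with lam_i left out, then k e_k = \sum_i lam_i q_(k-1), and
   log-concavity of q bounds the inclusion probability lam_i q_(k-1) / e_k by
   lam_i / (lam_i + b).  Hence k <= \sum_i lam_i / (lam_i + b).  The right-hand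
   side decreases in b and is at most k at a = Phi_s(k) OPT_k / k, so b <= a and
   E[Er(S)] <= (k+1)/k * Phi_s(k) OPT_k; finally (k+1)/k <= (1 + 2 eps)^2. *)

(** * Gram determinants and residuals of projections *)

(** The same permutation acts on rows and columns, so its two signs cancel. *)
Lemma det_mxsub_bij (T : comPzRingType) (q n : nat) (h : 'I_q -> 'I_n) (M : 'M[T]_n) :
  q = n -> injective h -> \det (mxsub h h M) = \det M.
Proof.
move=> eq_qn; subst q => inj_h.
have -> : mxsub h h M = row_perm (perm inj_h) (col_perm (perm inj_h) M).
  by apply/matrixP=> i j; rewrite !mxE !permE.
rewrite row_permE col_permE !det_mulmx !det_perm odd_permV.
by rewrite mulrCA -signr_addb addbb expr0 mulr1.
Qed.

(** [gram_det] lists S by [enum_val]; this permits any other listing, such as one that puts a new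
    column last. *)
Lemma gram_det_mxsub (R : realType) (m n p : nat) (A : 'M[R]_(m, n))
    (h : 'I_p -> 'I_n) :
  injective h -> \det (mxsub h h (A^T *m A)) = gram_det A [set h x | x : 'I_p].
Proof.
move=> inj_h; set S := [set _ | _ in _].
have card_S : p = #|S| by rewrite card_imset // cardT size_enum_ord.
have hS x : h x \in S by rewrite imset_f.
pose g x := enum_rank_in (hS x) (h x).
have gE x : enum_val (g x) = h x by rewrite enum_rankK_in.
have inj_g : injective g.
  by move=> x y /(congr1 enum_val); rewrite !gE => /inj_h.
rewrite /gram_det -(det_mxsub_bij _ _ _ _ _ card_S inj_g); congr (\det _).
by apply/matrixP => i j; rewrite !mxE !gE.
Qed.

(** If v C C^T = 0 then |v C|^2 = 0, so v C = 0 and freeness gives v = 0. Hence the [invmx] in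
    [projS] is a true inverse. *)
Lemma unitmx_mul_tr (R : realType) (r m : nat) (C : 'M[R]_(r, m)) :
  row_free C -> C *m C^T \in unitmx.
Proof.
move=> freeC; rewrite -row_free_unit -kermx_eq0; apply/eqP/row_matrixP => i.
rewrite row0; set v := row i _.
have v0 : v *m (C *m C^T) = 0 by apply/sub_kermxP; rewrite row_sub.
have : (v *m C) *m (v *m C)^T = 0 by rewrite trmx_mul !mulmxA -(mulmxA v) v0 mul0mx.
move=> /matrixP /(_ 0 0); rewrite !mxE => /eqP.
rewrite psumr_eq0; last by move=> j _; rewrite [_^T _ _]mxE -expr2 sqr_ge0.
move=> /allP vC0; apply/eqP; rewrite -(mulmx_free_eq0 _ freeC).
apply/eqP/rowP=> j; rewrite [RHS]mxE; apply/eqP.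
by have := vC0 j (mem_index_enum _); rewrite [_^T _ _]mxE -expr2 sqrf_eq0.
Qed.

Lemma colsS_projS (R : realType) (m n : nat) (A : 'M[R]_(m, n)) (S : {set 'I_n}) :
  colsS A S *m projS A S = colsS A S.
Proof.
rewrite /projS; set C := row_base _.
have /submxP[X BE] : (colsS A S <= C)%MS by rewrite eq_row_base.
have unitC : C *m C^T \in unitmx by apply/unitmx_mul_tr/row_base_free.
have CP : C *m (C^T *m invmx (C *m C^T) *m C) = C by rewrite !mulmxA mulmxV ?mul1mx.
by rewrite {1}BE -(mulmxA X) CP -BE.
Qed.

(** Supplies the coefficients that express a projected column in the columns of S, listed as in
    [gram_det]. *)
Lemma projS_range (R : realType) (m n : nat) (A : 'M[R]_(m, n)) (S : {set 'I_n}) :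
  exists W, projS A S = (rowsub (enum_val : 'I_#|S| -> _) A^T)^T *m W.
Proof.
rewrite /projS; set C := row_base _; set B := rowsub _ _.
have /submxP[X CE] : (C <= B)%MS.
  rewrite eq_row_base; apply/row_subP => i; case: (boolP (i \in S)) => iS.
    have -> : row i (colsS A S) = row (enum_rank_in iS i) B.
      by apply/rowP => j; rewrite !mxE enum_rankK_in // iS.
    exact: row_sub.
  have -> : row i (colsS A S) = 0 by apply/rowP => j; rewrite !mxE (negPf iS).
  exact: sub0mx.
exists (X^T *m (invmx (C *m C^T) *m C)).
by rewrite [RHS]mulmxA -trmx_mul -CE !mulmxA.
Qed.

(* Replacing a_j by its residual r is a unipotent change of the columns, and it
   makes the Gram matrix block diagonal with blocks A_S^T A_S and |r|^2. *)
Lemma gram_detU1 (R : realType) (m n : nat) (A : 'M[R]_(m, n)) (S : {set 'I_n})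
    (j : 'I_n) :
  j \notin S ->
  gram_det A (j |: S) =
    gram_det A S * \sum_(i < m) (A - projS A S *m A) i j ^+ 2.
Proof.
move=> jS; set B := rowsub (enum_val : 'I_#|S| -> _) A^T.
pose h (x : 'I_(#|S| + 1)) := if split x is inl a then enum_val a else j.
have inj_h : injective h.
  move=> x y; rewrite /h -{2}(splitK x) -{2}(splitK y).
  case: (split x) => a; case: (split y) => b /=.
  - by move=> /enum_val_inj ->.
  - by move=> ej; rewrite -ej enum_valP in jS.
  - by move=> ej; rewrite ej enum_valP in jS.
  - by rewrite (ord1 a) (ord1 b).
have im_h : [set h x | x : 'I_(#|S| + 1)] = j |: S.
  apply/setP => i; rewrite in_setU1; apply/imsetP/orP.
    case=> x _ ->; rewrite /h; case: (split x) => a; last by left.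
    by right; rewrite enum_valP.
  case=> [/eqP -> | iS].
    by exists (rshift #|S| ord0); rewrite // /h -[rshift _ _]/(unsplit (inr _)) unsplitK.
  exists (lshift 1 (enum_rank_in iS i)) => //.
  by rewrite /h -[lshift _ _]/(unsplit (inl _)) unsplitK enum_rankK_in.
rewrite -im_h -gram_det_mxsub //.
pose a := (col j A)^T; pose r := (col j (A - projS A S *m A))^T.
(* The residual is orthogonal to the selected columns; this clears the upper right block of the Gram
   matrix. *)
have Br : B *m r^T = 0.
  have -> : B = rowsub (enum_val : 'I_#|S| -> _) (colsS A S).
    by apply/matrixP => x y; rewrite !mxE enum_valP.
  rewrite trmxK colE mulmxA mul_rowsub_mx mulmxBr mulmxA colsS_projS subrr.
  by apply/matrixP => x y; rewrite !mxE big1 // => z _; rewrite !mxE mul0r.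
have [c rE] : exists c, r = a - c *m B.
  have [W PE] := projS_range _ _ _ A S.
  exists (col j (W *m A))^T; apply: trmx_inj.
  by rewrite linearB /= trmx_mul !trmxK !colE PE mulmxBl !mulmxA.
have -> : mxsub h h (A^T *m A) = col_mx B a *m (col_mx B a)^T.
  rewrite mxsub_mul; congr (_ *m _); last rewrite -[LHS]trmxK; last congr trmx;
  apply/matrixP => x y; rewrite !mxE /h; case: split => z; rewrite ?mxE //.
pose L : 'M[R]_(#|S| + 1) := block_mx 1%:M 0 (- c) 1%:M.
have LE : L *m col_mx B a = col_mx B r.
  by rewrite mul_block_col !mul1mx mul0mx addr0 rE mulNmx addrC.
have detL : \det L = 1 by rewrite det_lblock !det1 mulr1.
have : \det (L *m (col_mx B a *m (col_mx B a)^T) *m L^T) =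
       gram_det A S * \sum_(i < m) (A - projS A S *m A) i j ^+ 2.
  rewrite mulmxA LE -mulmxA -trmx_mul LE tr_col_mx mul_col_row Br.
  rewrite det_lblock; congr (_ * _); last first.
    rewrite det_mx11 !mxE; apply: eq_bigr => i _; rewrite !mxE -expr2 //.
  rewrite /gram_det; congr (\det _); apply/matrixP => x y; rewrite !mxE.
  by apply: eq_bigr => i _; rewrite !mxE.
by rewrite !det_mulmx det_tr detL mul1r mulr1.
Qed.

(** * Principal minors and the characteristic polynomial *)

(** Each row is a row of H plus a multiple of a unit row. In the expansion by multilinearity, S
    records the rows taken from H. *)
Lemma det_add_diag (T : comPzRingType) (n : nat) (d : 'I_n -> T) (H : 'M[T]_n) :
  \det (\matrix_(i, j) (H i j + d i *+ (i == j))) =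
  \sum_(S : {set 'I_n})
     \det (mxsub (enum_val : 'I_#|S| -> _) enum_val H) * \prod_(i in ~: S) d i.
Proof.
pose N (S : {set 'I_n}) : 'M_n :=
  \matrix_(i, j) (if i \in S then H i j else (i == j)%:R).
have NE S : \det (N S) = \det (mxsub (enum_val : 'I_#|S| -> _) enum_val H).
  pose h (x : 'I_(#|S| + #|~: S|)) :=
    match split x with inl a => enum_val a | inr b => enum_val b end.
  have inj_h : injective h.
    move=> x y; rewrite /h -{2}(splitK x) -{2}(splitK y).
    case: (split x) => a; case: (split y) => b /=.
    - by move=> /enum_val_inj ->.
    - by move=> e; have := enum_valP b; rewrite -e inE enum_valP.
    - by move=> e; have := enum_valP a; rewrite e inE enum_valP.
    - by move=> /enum_val_inj ->.
  have q_n : (#|S| + #|~: S|)%N = n by rewrite cardsC card_ord.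
  (* Listing S before its complement makes [N S] block upper triangular, with an identity as last
     block. *)
  rewrite -(det_mxsub_bij _ _ _ _ _ q_n inj_h).
  rewrite -(submxK (mxsub h h (N S))).
  have -> : dlsubmx (mxsub h h (N S)) = 0.
    apply/matrixP => x y; rewrite !mxE /h.
    rewrite -[lshift _ _]/(unsplit (inl _)) -[rshift _ _]/(unsplit (inr _)) !unsplitK.
    have := enum_valP x; rewrite inE => xS; rewrite (negPf xS).
    by case: eqP => // e; rewrite e enum_valP in xS.
  have -> : drsubmx (mxsub h h (N S)) = 1%:M.
    apply/matrixP => x y; rewrite !mxE /h.
    rewrite -[rshift _ x]/(unsplit (inr _)) -[rshift _ y]/(unsplit (inr _)) !unsplitK.
    have := enum_valP x; rewrite inE => xS; rewrite (negPf xS).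
    by rewrite (inj_eq enum_val_inj).
  rewrite det_ublock det1 mulr1; congr (\det _); apply/matrixP => x y; rewrite !mxE /h.
  rewrite -[lshift _ x]/(unsplit (inl _)) -[lshift _ y]/(unsplit (inl _)) !unsplitK.
  by rewrite enum_valP.
rewrite /determinant.
under eq_bigr => s _.
  under eq_bigr => i _ do rewrite mxE.
  rewrite bigA_distr big_distrr /=.
  over.
rewrite exchange_big /=; apply: eq_bigr => S _.
rewrite -[X in X * _]NE /determinant big_distrl /=; apply: eq_bigr => s _.
rewrite -mulrA; congr (_ * _).
rewrite [X in _ * X]big_mkcond -big_split /=; apply: eq_bigr => i _.
rewrite !mxE inE; case: ifP => _ /=; rewrite ?mulr1 // mulr_natl //.
Qed.

Definition elsym (T : comPzRingType) (n : nat) (lam : nat -> T) (k : nat) : T :=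
  \sum_(S : {set 'I_n} | #|S| == k) \prod_(i in S) lam i.

Lemma coef_prod_elsym (T : comNzRingType) (n : nat) (lam : nat -> T) (k : nat) :
  (\prod_(i < n) (1 + lam i *: 'X))`_k = elsym T n lam k.
Proof.
under eq_bigr => i _ do rewrite addrC.
rewrite bigA_distr coef_sum /elsym [RHS]big_mkcond; apply: eq_bigr => S _ /=.
rewrite -big_mkcond scaler_prod /= prodr_const coefZ coefXn mulr_natr mulrb.
by rewrite eq_sym.
Qed.

(** Compares the coefficients of X^(n-k) in the characteristic polynomial, once expanded by
    [det_add_diag] and once factored. Both carry the sign (-1)^k. *)
Lemma sum_gram_det (R : realType) (m n : nat) (A : 'M[R]_(m, n)) (lam : nat -> R)
    (k : nat) :
  char_poly (A^T *m A) = \prod_(i < n) ('X - (lam i)%:P) ->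
  \sum_(S : {set 'I_n} | #|S| == k) gram_det A S = elsym R n lam k.
Proof.
move=> charE.
(* For k > n both sums are empty; the case is split off because n - k truncates. *)
have [k_n|n_k] := leqP k n; last first.
  by rewrite /elsym !big_pred0 // => S; apply: contraTF n_k => /eqP <-;
     rewrite -leqNgt -[leqRHS]card_ord max_card.
have card_Sk (S : {set 'I_n}) : (n - k == n - #|S|)%N = (#|S| == k).
  have : (#|S| <= n)%N by rewrite -[leqRHS]card_ord max_card.
  by move=> Sn; rewrite -(eqn_add2r #|S|) subnK // addnBAC // -(eqn_add2r k) subnK
    ?(leq_trans k_n) ?leq_addr // eqn_add2l.
have cardC (S : {set 'I_n}) : #|~: S| = (n - #|S|)%N.
  by rewrite cardsCs setCK card_ord.
have splitX (S : {set 'I_n}) :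
    \prod_(i < n) (if i \in S then (- lam i)%:P else 'X)
    = (\prod_(i in S) - lam i)%:P * \prod_(i in ~: S) 'X.
  rewrite (bigID (mem S)) /= rmorph_prod /=; congr (_ * _).
    by apply: eq_bigr => i ->.
  by apply: eq_big => i; rewrite ?inE // => /negPf ->.
have coefS (S : {set 'I_n}) (c : R) :
    (c%:P * \prod_(i in ~: S) 'X)`_(n - k) = c *+ (#|S| == k).
  by rewrite prodr_const cardC coefCM coefXn card_Sk mulr_natr.
have prodE : \prod_(i < n) ('X - (lam i)%:P) =
    \sum_(S : {set 'I_n}) (\prod_(i in S) - lam i)%:P * \prod_(i in ~: S) 'X.
  under eq_bigr => i _ do rewrite addrC -polyCN.
  by rewrite bigA_distr; apply: eq_bigr => S _.
set G := A^T *m A in charE.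
have detE : char_poly G = \sum_(S : {set 'I_n})
    (\det (mxsub (enum_val : 'I_#|S| -> _) enum_val (- G)))%:P * \prod_(i in ~: S) 'X.
  rewrite /char_poly.
  have -> : char_poly_mx G =
      \matrix_(i, j) ((map_mx polyC (- G)) i j + 'X *+ (i == j)).
    by apply/matrixP => i j; rewrite !mxE polyCN addrC.
  rewrite det_add_diag; apply: eq_bigr => S _.
  by rewrite -map_mxsub det_map_mx.
have := congr1 (fun p : {poly R} => (-1) ^+ k * p`_(n - k)) charE.
rewrite /= detE prodE !coef_sum.
under [in LHS]eq_bigr => S _ do rewrite coefS mulrb.
under [in RHS]eq_bigr => S _ do rewrite coefS mulrb.
rewrite -!big_mkcond /= !big_distrr /= /elsym => H; apply: etrans (etrans H _).
  apply: eq_bigr => S /eqP Sk; rewrite /gram_det.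
  have -> : mxsub enum_val enum_val (- G) =
     -1 *: (\matrix_(i < #|S|, j < #|S|) G (enum_val i) (enum_val j)).
    by apply/matrixP => i j; rewrite !mxE mulN1r.
  by rewrite detZ mulrA -Sk -expr2 sqrr_sign mul1r.
apply: eq_bigr => S /eqP Sk.
by rewrite prodrN cardE -cardE Sk mulrA -expr2 sqrr_sign mul1r.
Qed.

(** * The expected error in terms of minors of size k+1 *)

Lemma trmx_projS (R : realType) (m n : nat) (A : 'M[R]_(m, n)) (S : {set 'I_n}) :
  (projS A S)^T = projS A S.
Proof. by rewrite /projS !trmx_mul trmx_inv !trmx_mul !trmxK mulmxA. Qed.

(** By [gram_detU1] the left side runs over pairs of S and j outside S; each T of size k+1 arises
    from k+1 pairs, one for each j removed. *)
Lemma sum_gram_det_Er (R : realType) (m n : nat) (A : 'M[R]_(m, n)) (k : nat) :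
  \sum_(S : {set 'I_n} | #|S| == k) gram_det A S * Er A S =
  k.+1%:R * \sum_(T : {set 'I_n} | #|T| == k.+1) gram_det A T.
Proof.
have ErE S : gram_det A S * Er A S = \sum_(j in ~: S) gram_det A (j |: S).
  (* Columns in S are fixed by the projection, so only j outside S contribute. *)
  rewrite /Er /frob2 exchange_big /= (bigID (mem S)) /= big1 ?add0r; last first.
    move=> j jS; apply: big1 => i _.
    have colj : (row j (colsS A S))^T = col j A.
      by apply/matrixP => x y; rewrite !mxE jS.
    have Pj : projS A S *m col j A = col j A.
      by rewrite -colj -{1}(trmx_projS _ _ _ A S) -trmx_mul -row_mul colsS_projS.
    have /colP/(_ i) : col j (A - projS A S *m A) = 0.
      by rewrite linearB /= [col j (_ *m _)]colE -mulmxA -colE Pj subrr.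
    by rewrite !mxE => ->; rewrite expr0n.
  rewrite big_distrr /=; apply: eq_big => [j | j jS]; first by rewrite inE.
  by rewrite gram_detU1.
under eq_bigr => S _ do rewrite ErE.
rewrite pair_big_dep /= big_distrr /=.
transitivity (\sum_(T : {set 'I_n} | #|T| == k.+1) \sum_(j in T) gram_det A T).
  rewrite pair_big_dep /=.
  rewrite (reindex_onto (fun p : {set 'I_n} * 'I_n => (p.1 :\ p.2, p.2))
                        (fun p => (p.2 |: p.1, p.2))) /=.
    apply: eq_big => [[T j]|[T j]] /=.
      rewrite !inE eqxx /=; case: (boolP (j \in T)) => jT.
        by rewrite setD1K // (cardsD1 j T) jT eqxx !andbT.
      rewrite andbF; apply/negP => /andP[_ /eqP[E]]; move: jT.
      by rewrite -E setU11.
    by case/andP=> /andP[_ _] /eqP[->].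
  move=> [S j] /=; rewrite inE => /andP[_ jS]; by rewrite setU1K.
apply: eq_bigr => T /eqP cT.
by rewrite sumr_const cT mulr_natl.
Qed.

(** * Log-concavity and inclusion probabilities *)

(* Asking for all i <= j, and not only i = j, makes this stable under products
   even when the sequence vanishes somewhere. *)
Definition log_concave (R : realDomainType) (p : nat -> R) :=
  (forall i, 0 <= p i) /\
  forall i j, (i <= j)%N -> p i * p j.+2 <= p i.+1 * p j.+1.

(** After expansion the inequality holds separately in each power of x; in degree one the products
    p_(i+1) p_(j+1) cancel. *)
Lemma log_concave_mul (R : realDomainType) (p : {poly R}) (x : R) :
  0 <= x -> log_concave R (nth 0 p) -> log_concave R (nth 0 ((1 + x *: 'X) * p)).
Proof.
move=> x0 [p0 pc].
have cE i : ((1 + x *: 'X) * p)`_i = p`_i + (if i is j.+1 then x * p`_j else 0).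
  by rewrite mulrDl mul1r coefD -scalerAl coefZ coefXM; case: i => //=; rewrite mulr0.
split=> [i|i j ij]; rewrite !cE.
  by case: i => [|i]; rewrite ?addr0 // addr_ge0 ?mulr_ge0.
have pc1 := pc _ _ ij.
have pc3 : p`_i * p`_j.+1 <= p`_i.+1 * p`_j.
  move: ij; rewrite leq_eqVlt => /orP[/eqP -> | ]; first by rewrite mulrC.
  by case: j {pc1} => // j ij; apply: pc.
case: i ij pc1 pc3 => [|i] ij pc1 pc3.
  have := mulr_ge0 x0 (mulr_ge0 (p0 1%N) (p0 j)).
  have := mulr_ge0 (mulr_ge0 x0 x0) (mulr_ge0 (p0 0%N) (p0 j)).
  nra.
have pc2 : p`_i * p`_j.+1 <= p`_i.+1 * p`_j.
  by case: j ij {pc1 pc3} => // j ij; apply: pc.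
(* This is the degree-one comparison, obtained by moving the two indices towards each other
   twice. *)
have pc4 : p`_i * p`_j.+2 <= p`_i.+2 * p`_j.
  apply: le_trans pc3; apply: pc; exact: ltnW.
have := ler_wpM2l x0 pc4.
have := ler_wpM2l (mulr_ge0 x0 x0) pc2.
nra.
Qed.

Lemma log_concave_prod (R : realDomainType) (n : nat) (lam : nat -> R) (P : pred 'I_n) :
  (forall i : 'I_n, 0 <= lam i) ->
  log_concave R (nth 0 (\prod_(i < n | P i) (1 + lam i *: 'X))).
Proof.
move=> lam0; elim/big_rec: _ => [|i p _ lc]; last exact: log_concave_mul.
split=> [i|i j _]; rewrite !coef1; first exact: ler0n.
by rewrite /= mulr0 mul0r.
Qed.

(** Both sides count every subset of size k+1 once for each of its elements. The induction peels off
    the last factor. *)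
Lemma sum_coef_del (R : comNzRingType) (n : nat) (lam : nat -> R) (k : nat) :
  \sum_(i < n) lam i * (\prod_(j < n | j != i) (1 + lam j *: 'X))`_k =
  k.+1%:R * (\prod_(i < n) (1 + lam i *: 'X))`_k.+1.
Proof.
elim: n => [|n IHn] in k *; first by rewrite !big_ord0 coef1 mulr0.
have cE (p : {poly R}) x i : (p * (1 + x *: 'X))`_i = p`_i + x * (if i is j.+1 then p`_j else 0).
  by rewrite mulrDr mulr1 coefD -scalerAr coefZ coefMX; case: i.
rewrite big_ord_recr [in RHS]big_ord_recr /= cE.
have -> : \prod_(j < n.+1 | j != ord_max) (1 + lam j *: 'X) = \prod_(j < n) (1 + lam j *: 'X).
  rewrite big_mkcond big_ord_recr /= eqxx mulr1; apply: eq_bigr => i _.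
  by rewrite -val_eqE /= ltn_eqF.
have delE (i : 'I_n) : \prod_(j < n.+1 | j != widen_ord (leqnSn n) i) (1 + lam j *: 'X)
    = \prod_(j < n | j != i) (1 + lam j *: 'X) * (1 + lam n *: 'X).
  by rewrite big_mkcond big_ord_recr /= -big_mkcond -val_eqE /= gtn_eqF.
under eq_bigr => i _ do rewrite delE cE mulrDr mulrCA.
rewrite big_split /= -big_distrr /= IHn.
case: k => [|k]; rewrite /= ?IHn.
  rewrite [X in _ + _ * X + _]big1 => [|i _]; last exact: mulr0.
  by rewrite mulr0 addr0 !mul1r.
rewrite [k.+2%:R]mulrS; ring.
Qed.

Lemma elsym_ratio_sum (R : realFieldType) (n : nat) (lam : nat -> R) (k : nat) :
  (forall i : 'I_n, 0 <= lam i) ->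
  let b := elsym R n lam k.+1 / elsym R n lam k in
  0 < elsym R n lam k -> 0 < b ->
  k%:R <= \sum_(i < n) lam i / (lam i + b).
Proof.
move=> lam0 b ek b0; case: k @b ek b0 => [|k] b ek b0.
  by apply: sumr_ge0 => i _; rewrite divr_ge0 // addr_ge0 // ltW.
rewrite -(ler_pM2r ek) -{1}coef_prod_elsym -sum_coef_del mulr_suml.
apply: ler_sum => i _; rewrite -mulrA; apply: ler_wpM2l => //.
rewrite mulrC ler_pdivlMr ?ltr_wpDl //.
have [q0 qc] := log_concave_prod R n lam (fun j => j != i) lam0.
set q := \prod_(j < n | _) _ in q0 qc *.
have pE j : elsym R n lam j.+1 = q`_j.+1 + lam i * q`_j.
  by rewrite -coef_prod_elsym (bigD1 i) //= -/q mulrDl mul1r coefD -scalerAl coefZ coefXM.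
(* With e_(k+1) = q_(k+1) + lam_i q_k, the terms lam_i q_k cancel and b q_k <= q_(k+1) remains.
   Expanding b turns this into q_k q_(k+2) <= q_(k+1)^2. *)
rewrite mulrDr {1}pE addrC lerD //; last by rewrite mulrC.
rewrite /b mulrA ler_pdivrMr // !pE.
have := qc k k (leqnn _); nra.
Qed.

(** * Nonnegativity of the spectrum and an upper bound on the ratio b *)

Lemma gram_eigenvalue_ge0 (R : realType) (m n : nat) (A : 'M[R]_(m, n)) (a : R) :
  eigenvalue (A^T *m A) a -> 0 <= a.
Proof.
have normE p (v : 'rV[R]_p) : (v *m v^T) 0 0 = \sum_j v 0 j ^+ 2.
  by rewrite mxE; apply: eq_bigr => j _; rewrite mxE -expr2.
case/eigenvalueP => v vG v0.
have /matrixP/(_ 0 0) : (v *m A^T) *m (v *m A^T)^T = a *: (v *m v^T).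
  by rewrite trmx_mul trmxK mulmxA -(mulmxA v) vG scalemxAl.
rewrite normE [RHS]mxE normE => avE.
have v2_gt0 : 0 < \sum_j v 0 j ^+ 2.
  rewrite lt_neqAle sumr_ge0 ?andbT => [|j _]; last exact: sqr_ge0.
  apply: contra v0; rewrite eq_sym psumr_eq0 => [/allP v2|j _]; last exact: sqr_ge0.
  apply/eqP/rowP => j; rewrite mxE; apply/eqP.
  by have := v2 j (mem_index_enum _); rewrite sqrf_eq0.
by rewrite -(pmulr_lge0 _ v2_gt0) -avE sumr_ge0 // => j _; exact: sqr_ge0.
Qed.

Lemma elsym_ge0 (R : realFieldType) (n : nat) (lam : nat -> R) (k : nat) :
  (forall i : 'I_n, 0 <= lam i) -> 0 <= elsym R n lam k.
Proof. by move=> lam0; apply: sumr_ge0 => S _; apply: prodr_ge0. Qed.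

(** The sum of lam_i / (lam_i + b) decreases strictly in b because some lam_i is positive, so b > a
    would contradict [elsym_ratio_sum]. *)
Lemma elsym_ratio_le (R : realFieldType) (n : nat) (lam : nat -> R) (k : nat) (a : R) :
  (forall i : 'I_n, 0 <= lam i) -> (exists i : 'I_n, 0 < lam i) -> 0 < a ->
  0 < elsym R n lam k -> \sum_(i < n) lam i / (lam i + a) <= k%:R ->
  elsym R n lam k.+1 / elsym R n lam k <= a.
Proof.
move=> lam0 [i0 i0_gt0] a0 ek sum_le; rewrite leNgt; apply/negP => ab.
have := elsym_ratio_sum _ _ _ _ lam0 ek (lt_trans a0 ab).
apply/negP; rewrite -ltNge; apply: lt_le_trans sum_le.
set b := _ / _ in ab *; have b0 := lt_trans a0 ab.
have le_term (i : 'I_n) : lam i / (lam i + b) <= lam i / (lam i + a).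
  apply: ler_wpM2l => //; rewrite lef_pV2 ?posrE ?ltr_wpDl //.
  by rewrite lerD2l ltW.
rewrite (bigD1 i0) //= [ltRHS](bigD1 i0) //=; apply: ltr_leD; last exact: ler_sum.
by rewrite ltr_pM2l // ltf_pV2 ?posrE ?ltrD2l ?ltr_wpDl.
Qed.

(** * The effective dimension at the level a *)

(* Tangent line at u of the concave map x |-> x / (x + a). *)
Lemma concave_div_le (R : realFieldType) (x u a : R) :
  0 <= x -> 0 <= u -> 0 < a ->
  x / (x + a) <= (u / (u + a)) ^+ 2 + x * (a / (u + a) ^+ 2).
Proof.
move=> x0 u0 a0; rewrite -subr_ge0.
have xa : x + a != 0 by rewrite gt_eqF // ltr_wpDl.
have ua : u + a != 0 by rewrite gt_eqF // ltr_wpDl.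
have -> : (u / (u + a)) ^+ 2 + x * (a / (u + a) ^+ 2) - x / (x + a) =
    a * (x - u) ^+ 2 / ((x + a) * (u + a) ^+ 2).
  by field; rewrite xa ua.
apply: divr_ge0; apply: mulr_ge0; rewrite ?sqr_ge0 //; first exact: ltW.
by rewrite addr_ge0 // ltW.
Qed.

(** Eliminating T leaves (K + x) l <= (g^2 - g + 1) D. As D >= x l, it suffices that g x <= x + K,
    which holds because (g x)^2 = x (x + 2 K) <= (x + K)^2. *)
Lemma sqrt_gap_ineq (R : realFieldType) (K x l T D g : R) :
  0 < K -> 0 < x -> 0 < l -> T <= K * l -> T + D = (K + x) * l ->
  0 <= g -> g ^+ 2 * x = x + 2 * K -> T + g * D <= g ^+ 2 * D.
Proof.
move=> K0 x0 l0 TK TD g0 g2x.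
have gx : g * x <= x + K.
  have gx0 : 0 <= g * x by rewrite mulr_ge0 // ltW.
  have xK0 : 0 <= x + K by rewrite addr_ge0 // ltW.
  rewrite -ler_sqr ?nnegrE // exprMn [x ^+ 2]expr2 mulrA g2x; nra.
have TE : T = (K + x) * l - D by rewrite -TD addrK.
have Dx : x * l <= D by nra.
have c0 : 0 <= g ^+ 2 - g + 1 by nra.
have := ler_wpM2l c0 Dx.
have := ler_wpM2r (ltW l0) gx.
have := congr1 (fun z => z * l) g2x => /=.
rewrite TE; nra.
Qed.

(* The s leading terms contribute at most s, the next k - s are bounded by
   concavity, and the remaining ones by lam i / a. *)
Lemma effective_dim_le (R : realType) (n s k : nat) (lam : nat -> R) (l x : R) :
  (s < k <= n)%N -> (forall i, (i < n)%N -> 0 <= lam i) ->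
  (forall i, (s <= i < n)%N -> lam i <= l) -> 0 < l -> 0 < x ->
  \sum_(s <= i < n) lam i = (k%:R - s%:R + x) * l ->
  let D := \sum_(k <= i < n) lam i in
  let a := Num.sqrt (1 + 2 * (k%:R - s%:R) / x) * D / (k%:R - s%:R) in
  0 < D /\ \sum_(0 <= i < n) lam i / (lam i + a) <= k%:R.
Proof.
move=> /andP[sk kn] lam0 laml l0 x0.
set K := k%:R - s%:R => sumE D; set g := Num.sqrt _ => a.
have K0 : 0 < K by rewrite subr_gt0 ltr_nat.
have cardK : \sum_(s <= i < k) (1 : R) = K.
  by rewrite big_const_nat iter_addr_0 natrB // ltnW.
pose T := \sum_(s <= i < k) lam i.
have TD : T + D = (K + x) * l.
  by rewrite -sumE /T /D [RHS](big_cat_nat (ltnW sk) kn).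
have TK : T <= K * l.
  rewrite -cardK mulr_suml; apply: ler_sum_nat => i /andP[si ik].
  by rewrite mul1r laml // si (leq_trans ik).
have T0 : 0 <= T.
  rewrite /T big_nat; apply: sumr_ge0 => i /andP[_ ik]; apply: lam0.
  exact: leq_trans ik kn.
have D0 : 0 < D by nra.
have h0 : 0 <= 2 * K / x by rewrite divr_ge0 ?mulr_ge0 // ltW.
have g0 : 0 < g by rewrite sqrtr_gt0 ltr_wpDr.
have a0 : 0 < a by rewrite divr_gt0 ?mulr_gt0.
have g2x : g ^+ 2 * x = x + 2 * K.
  by rewrite sqr_sqrtr ?addr_ge0 //; field; rewrite gt_eqF.
have gap := sqrt_gap_ineq _ _ _ _ _ _ _ K0 x0 l0 TK TD (ltW g0) g2x.
split=> //.
rewrite (big_cat_nat (leq0n s) (leq_trans (ltnW sk) kn)) /=.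
rewrite [X in _ + X](big_cat_nat (ltnW sk) kn) /=.
have part1 : \sum_(0 <= i < s) lam i / (lam i + a) <= s%:R.
  have -> : s%:R = \sum_(0 <= i < s) (1 : R).
    by rewrite big_const_nat iter_addr_0 subn0.
  apply: ler_sum_nat => i /andP[_ si].
  have li := lam0 i (leq_trans si (leq_trans (ltnW sk) kn)).
  by rewrite ler_pdivrMr ?ltr_wpDl // mul1r lerDl ltW.
have part3 : \sum_(k <= i < n) lam i / (lam i + a) <= D / a.
  rewrite /D mulr_suml; apply: ler_sum_nat => i /andP[_ i_n].
  apply: ler_wpM2l; first exact: lam0.
  by rewrite lef_pV2 ?posrE ?ltr_wpDl ?lam0 // lerDr lam0.
have part2 : \sum_(s <= i < k) lam i / (lam i + a) <= K * (T / (T + g * D)).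
  (* The tangent point u is the mean of the middle eigenvalues, so the tangent bounds add up to
     exactly K u / (u + a). *)
  pose u := T / K; have u0 : 0 <= u by rewrite divr_ge0 // ltW.
  apply: (@le_trans _ _ (\sum_(s <= i < k)
      ((u / (u + a)) ^+ 2 * 1 + lam i * (a / (u + a) ^+ 2)))).
    apply: ler_sum_nat => i /andP[_ ik]; rewrite mulr1; apply: concave_div_le => //.
    exact/lam0/(leq_trans ik kn).
  rewrite big_split /= -big_distrr -mulr_suml /= -/T cardK le_eqVlt; apply/orP; left.
  apply/eqP; rewrite /u /a; field.
  by rewrite (gt_eqF K0) gt_eqF // ltr_wpDl // mulr_gt0.
have Da : D / a = K / g.
  by rewrite /a; field; rewrite (gt_eqF K0) (gt_eqF g0) (gt_eqF D0).
have TgD : 0 < T + g * D by rewrite ltr_wpDl // mulr_gt0.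
(* Clearing denominators turns this into [gap]. *)
have key : K * (T / (T + g * D)) + K / g <= K.
  rewrite -subr_ge0.
  have -> : K - (K * (T / (T + g * D)) + K / g) =
      K * (g ^+ 2 * D - (T + g * D)) / (g * (T + g * D)).
    by field; rewrite (gt_eqF TgD) (gt_eqF g0).
  apply: divr_ge0; apply: mulr_ge0; try exact: ltW.
  by rewrite subr_ge0.
have kE : k%:R = s%:R + K by rewrite addrC subrK.
rewrite Da in part3; rewrite kE; lra.
Qed.

(** * The constants in epsilon and the final estimate *)

(** Used with x = k - s to absorb the factor (k+1)/k. Since ln(1/eps) >= 1 - eps >= 1/2, x is at
    least 7 / (4 eps^4), and eps^4 <= eps. *)
Lemma eps_bound (R : realType) (eps x : R) :
  0 < eps -> eps <= 1 / 2 -> 7 / eps ^+ 4 * (ln (1 / eps)) ^+ 2 <= x ->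
  0 < x /\ 1 <= 4 * eps * x.
Proof.
move=> e0 e2 lex.
have e1 : eps <= 1 by lra.
have ln_ge : 1 / 2 <= ln (1 / eps).
  rewrite (div1r eps) lnV ?posrE //.
  have := @le_ln1Dx R (eps - 1); rewrite [1 + _]addrC subrK.
  by move=> /(_ ltac:(lra)); lra.
have ln2_ge : 1 / 4 <= ln (1 / eps) ^+ 2 by nra.
have e4 : 0 < eps ^+ 4 by rewrite exprn_gt0.
have e4i : 0 < (eps ^+ 4)^-1 by rewrite invr_gt0.
have lex' : 7 / 4 / eps ^+ 4 <= x.
  apply: le_trans lex; nra.
have e43 : eps ^+ 4 <= eps by rewrite -{2}[eps]expr1; apply: ler_wiXn2l => //; lra.
have : 7 / 4 <= x * eps ^+ 4 by rewrite -ler_pdivrMr.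
have x0 : 0 < x by apply: lt_le_trans lex'; rewrite divr_gt0 //; lra.
by nra.
Qed.

Theorem theorem1 (R : realType) (m n : nat) (A : 'M[R]_(m, n)) (lam : nat -> R)
    (s k : nat) (eps : R) :
  sorted_eigenvalues A lam ->
  (s < \rank A)%N ->
  0 < eps -> eps <= 1 / 2 ->
  s%:R + 7 / eps ^+ 4 * (ln (1 / eps)) ^+ 2 <= k%:R ->
  k%:R <= s%:R + stable_rank n lam s - 1 ->
  dpp_expected_Er A k / OPT n lam k
    <= (1 + 2 * eps) ^+ 2 * Phi s (s%:R + stable_rank n lam s) k.
Proof.
move=> [charE lam_sorted] s_rank eps0 eps2 k_ge k_le.
have [K0 epsK] : 0 < k%:R - s%:R :> R /\ 1 <= 4 * eps * (k%:R - s%:R).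
  by apply: eps_bound => //; rewrite lerBrDl.
have sk : (s < k)%N by rewrite -(ltr_nat R) -subr_gt0.
have sn : (s < n)%N := leq_trans s_rank (rank_leq_col A).
have lam0 i : (i < n)%N -> 0 <= lam i.
  move=> i_n; apply: (gram_eigenvalue_ge0 _ _ _ A).
  rewrite eigenvalue_root_char charE rootE horner_prod (bigD1 (Ordinal i_n)) //=.
  by rewrite hornerXsubC subrr mul0r.
have lam_le i : (s <= i < n)%N -> lam i <= lam s by exact: lam_sorted.
have sumE : stable_rank n lam s = (\sum_(s <= i < n) lam i) / lam s.
  by rewrite /stable_rank big_geq_mkord.
(* Were [lam s] zero, the stable rank would be 0 by the convention on inverses, forcing k <= s -
   1. *)
have l0 : 0 < lam s.
  rewrite lt_neqAle lam0 // andbT; apply/eqP => l0.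
  by move: k_le; rewrite sumE -l0 invr0 mulr0; lra.
have {}sumE : \sum_(s <= i < n) lam i = stable_rank n lam s * lam s.
  by rewrite sumE mulfVK // gt_eqF.
set r := stable_rank n lam s in k_le sumE *.
(* Each lam_i with i >= s is at most lam_s, so the stable rank r is at most n - s. *)
have kn : (k <= n)%N.
  have : r * lam s <= (n%:R - s%:R) * lam s.
    rewrite -sumE -natrB 1?ltnW // -[_%:R]iter_addr_0 -big_const_nat mulr_suml.
    by apply: ler_sum_nat => i i_n; rewrite mul1r lam_le.
  by rewrite ler_pM2r // -(ler_nat R); lra.
(* The gap x is t_s - k, chosen so that (k - s) + x = r. *)
have x0 : 0 < s%:R + r - k%:R by lra.
have skn : (s < k <= n)%N by rewrite sk.
have sumE' : \sum_(s <= i < n) lam i = (k%:R - s%:R + (s%:R + r - k%:R)) * lam s.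
  by rewrite sumE; ring.
have [] := effective_dim_le _ _ _ _ _ _ _ skn lam0 lam_le l0 x0 sumE'.
set g := Num.sqrt _.
have OPTE : \sum_(k <= i < n) lam i = OPT n lam k by rewrite big_geq_mkord.
rewrite OPTE big_mkord; set D := OPT n lam k => D0 dim_le.
have g0 : 0 < g by rewrite sqrtr_gt0 ltr_wpDr ?divr_ge0 ?mulr_ge0 // ltW.
have lam0' (i : 'I_n) : 0 <= lam i by exact: lam0.
rewrite /Phi -/g /dpp_expected_Er sum_gram_det_Er !(sum_gram_det _ _ _ _ _ _ charE).
set E := _ / elsym R n lam k.
have {dim_le} E_le : E <= k.+1%:R * (g * D / (k%:R - s%:R)).
  (* If e_k vanishes, the quotient is 0 by convention and the bound is trivial. *)
  rewrite /E; have [ek|ek] := eqVneq (elsym R n lam k) 0.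
    by rewrite ek invr0 mulr0 mulr_ge0 // divr_ge0 ?mulr_ge0 // ltW.
  rewrite -[X in X <= _]mulrA; apply: ler_wpM2l; first exact: ler0n.
  apply: elsym_ratio_le => //.
  - by exists (Ordinal sn).
  - by rewrite divr_gt0 ?mulr_gt0.
  - by rewrite lt_neqAle eq_sym ek elsym_ge0.
rewrite ler_pdivrMr //; apply: (le_trans E_le).
(* Since 1 + s/(k-s) = k/(k-s), both sides share the factor a, and k + 1 <= (1 + 2 eps)^2 k remains.
   It follows from 1 <= 4 eps (k - s) <= 4 eps k. *)
have -> : (1 + 2 * eps) ^+ 2 * ((1 + s%:R / (k%:R - s%:R)) * g) * D =
    ((1 + 2 * eps) ^+ 2 * k%:R) * (g * D / (k%:R - s%:R)).
  by field; rewrite gt_eqF.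
apply: ler_wpM2r; first by rewrite divr_ge0 ?mulr_ge0 // ltW.
have s0 : 0 <= s%:R :> R by exact: ler0n.
rewrite -natr1; nra.
Qed.
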